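(* Let $(\gamma,\widetilde\gamma)$ be a non-helical and non-planar Bertrand pair in Euclidean 3-space, parameterized by the arclengths $s$ and $s^{*}$ respectively ($\gamma$ the Bertrand curve, $\widetilde\gamma$ its mate). Then: (i) the Bertrand mate curve $\widetilde\gamma$ is a slant helix if and only if the tangent indicatrix $\widetilde\gamma_t=\widetilde T$ of $\widetilde\gamma$ is a spherical helix; (ii) the Bertrand curve $\gamma$ is a slant helix if and only if the tangent indicatrix $\widetilde\gamma_t=\widetilde T$ of the mate $\widetilde\gamma$ is a spherical helix; (iii) the Bertrand curve $\gamma$ is a slant helix if and only if the tangent indicatrix $\gamma_t=T$ of $\gamma$ is a spherical helix.
   Context: Curves are smooth regular curves in $\mathbb{R}^3$ with non-vanishing curvature; $\gamma$ has Frenet frame $T,N,B$, curvature $\kappa$, torsion $\tau$, and $\widetilde\gamma$ has $\widetilde T,\widetilde N,\widetilde B,\widetilde\kappa,\widetilde\tau$. The pair $(\gamma,\widetilde\gamma)$ is a Bertrand pair if there is a correspondence of points such that the principal normals at corresponding points are linearly dependent, $N=\epsilon\widetilde N$ with $\epsilon=\pm1$, and $\widetilde\gamma(s^{*})=\gamma(s)+\lambda N(s)$ with $\lambda\neq0$ constant. Non-helical means that torsion/curvature of each curve is not constant, non-planar that the torsions are non-zero; the quotients $\tau/\kappa$, $\tau'/\kappa'$, $\widetilde\tau/\widetilde\kappa$, $\widetilde\tau'/\widetilde\kappa'$ are assumed to be defined (denominators non-zero, and the two quotients of each curve different and non-zero at each point). A slant helix is a curve whose principal normal lines make a constant angle with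 a fixed straight line. The tangent indicatrices are the curves $s\mapsto T(s)$ and $s^{*}\mapsto\widetilde T(s^{*})$ on the unit sphere. A spherical helix is a curve on the sphere which is a (general) helix, i.e. the ratio of its torsion to its curvature is constant. *)

(* Defs.v *)
From HB Require Import structures.
From mathcomp Require Import all_boot all_order all_algebra.
From mathcomp Require Import all_classical all_reals all_analysis.

Set Implicit Arguments.
Unset Strict Implicit.
Unset Printing Implicit Defensive.

Import Order.TTheory GRing.Theory Num.Theory.
Import numFieldNormedType.Exports.

Local Open Scope classical_set_scope.
Local Open Scope ring_scope.

Section Euclidean3.
Variable R : realType.
Implicit Types u v : 'rV[R]_3.

Definition dot u v : R := \sum_(i < 3) u 0 i * v 0 i.

(* The library's `|u| on row vectors is the sup norm, hence this definition. *)
Definition enorm u : R := Num.sqrt (dot u u).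

(* The additions on i : 'I_3 are modulo 3. *)
Definition cross u v : 'rV[R]_3 :=
  \row_(i < 3) (u 0 (i + 1) * v 0 (i - 1) - u 0 (i - 1) * v 0 (i + 1)).

(* Unoriented angle, in [0, pi/2], between the lines directed by u and v. *)
Definition line_angle u v : R := acos (`|dot u v| / (enorm u * enorm v)).

End Euclidean3.

Section Frenet.
Variable R : realType.
Implicit Types (I J : set R) (a : R -> 'rV[R]_3) (t : R).

(* Derivative of the vector field X along the curve a, with respect to the
   arclength of a: d/ds = |a'|^-1 d/dt.  The Frenet apparatus below is thus the
   usual one for any regular parametrization; when |a'| = 1, arc_derive a X is
   just X'. *)
Definition arc_derive a (X : R -> 'rV[R]_3) t : 'rV[R]_3 :=
  (enorm (derive1 a t))^-1 *: derive1 X t.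

Definition tangent a t : 'rV[R]_3 := arc_derive a a t.

Definition curvature a t : R := enorm (arc_derive a (tangent a) t).

Definition normal a t : 'rV[R]_3 :=
  (curvature a t)^-1 *: arc_derive a (tangent a) t.

Definition binormal a t : 'rV[R]_3 := cross (tangent a t) (normal a t).

(* Sign convention: dB/ds = - tau N. *)
Definition torsion a t : R :=
  - dot (arc_derive a (binormal a) t) (normal a t).

Definition smooth_on I a : Prop :=
  forall (n : nat) t, I t -> derivable (derive1n n a) t 1.

Definition frenet_curve I a : Prop :=
  [/\ open I, is_interval I, I !=set0 & smooth_on I a] /\
  (forall t, I t -> derive1 a t != 0 /\ curvature a t != 0).

Definition arclength_param I a : Prop := forall t, I t -> enorm (derive1 a t) = 1.

Definition general_helix I a : Prop :=
  exists c : R, forall t, I t -> torsion a t / curvature a t = c.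

Definition non_planar I a : Prop := forall t, I t -> torsion a t != 0.

(* For a curve parametrized by arclength, so that the primes are plain
   derivatives of the real functions torsion and curvature. *)
Definition admissible_quotients I a : Prop :=
  forall t, I t ->
    [/\ curvature a t != 0, derive1 (curvature a) t != 0,
        torsion a t / curvature a t != 0,
        derive1 (torsion a) t / derive1 (curvature a) t != 0 &
        torsion a t / curvature a t !=
          derive1 (torsion a) t / derive1 (curvature a) t].

Definition slant_helix I a : Prop :=
  frenet_curve I a /\
  exists u : 'rV[R]_3, u != 0 /\
    exists theta : R, forall t, I t -> line_angle (normal a t) u = theta.

Definition spherical_helix I a : Prop :=
  [/\ frenet_curve I a, forall t, I t -> enorm (a t) = 1 & general_helix I a].

(* phi is the correspondence s |-> s^* between the points of the two curves. *)
Definition bertrand_pair I J a b : Prop :=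
  exists phi : R -> R, set_bij I J phi /\
  exists eps lambda : R,
    [/\ eps = 1 \/ eps = -1, lambda != 0 &
        forall s, I s ->
          normal a s = eps *: normal b (phi s) /\
          b (phi s) = a s + lambda *: normal a s].

End Frenet.

(* Main.v *)
(* For a unit-speed curve g, the principal normal N of g is the tangent of the
   curve s |-> T(s).  By Lancret's theorem the ratio torsion/curvature of a
   regular curve is constant iff its tangent makes a constant angle with a fixed
   direction; applied to s |-> T(s) this says that T is a helix iff N . u is
   constant for some u != 0, i.e. iff g is a slant helix.  Curves of a Bertrand
   pair have the same principal normal lines at corresponding points, so one is
   a slant helix iff the other is. *)
Require Import Defs.
From HB Require Import structures.
From mathcomp Require Import all_boot all_order all_algebra.
From mathcomp Require Import all_classical all_reals all_analysis.
From mathcomp Require Import ring lra.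

Set Implicit Arguments.
Unset Strict Implicit.
Unset Printing Implicit Defensive.

Import Order.TTheory GRing.Theory Num.Theory.
Import numFieldNormedType.Exports.

Local Open Scope classical_set_scope.
Local Open Scope ring_scope.

(** * Algebra of the dot and cross products in coordinates *)

Section DotCross.
Variable R : realType.
Implicit Types u v w x : 'rV[R]_3.

(** The three indices are named 0, 1, -1 to match the cyclic indices of [cross], so that vector
    identities become polynomial identities for [ring]. *)
Lemma dotE u v : dot u v = u 0 0 * v 0 0 + u 0 1 * v 0 1 + u 0 (-1) * v 0 (-1).
Proof.
rewrite /dot !big_ord_recl big_ord0 addr0 addrA.
by congr (_ + _ * _ + _ * _); congr (_ _ _); apply/val_inj.
Qed.

Lemma crossE u v : [/\ cross u v 0 0 = u 0 1 * v 0 (-1) - u 0 (-1) * v 0 1,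
  cross u v 0 1 = u 0 (-1) * v 0 0 - u 0 0 * v 0 (-1) &
  cross u v 0 (-1) = u 0 0 * v 0 1 - u 0 1 * v 0 0].
Proof.
by split; rewrite mxE; congr (_ * _ - _ * _); congr (_ _ _); apply/val_inj.
Qed.

Lemma eq_row3 u v :
  u 0 0 = v 0 0 -> u 0 1 = v 0 1 -> u 0 (-1) = v 0 (-1) -> u = v.
Proof.
move=> e0 e1 e2; apply/rowP => -[[|[|[|//]]] i3].
- by rewrite (_ : Ordinal i3 = 0) //; exact/val_inj.
- by rewrite (_ : Ordinal i3 = 1) //; exact/val_inj.
- by rewrite (_ : Ordinal i3 = -1) //; exact/val_inj.
Qed.

Lemma dotC u v : dot u v = dot v u.
Proof. by rewrite !dotE; ring. Qed.

Lemma dotDl u v w : dot (u + v) w = dot u w + dot v w.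
Proof. by rewrite !dotE !mxE; ring. Qed.

Lemma dotZl k u v : dot (k *: u) v = k * dot u v.
Proof. by rewrite !dotE !mxE; ring. Qed.

Lemma dotZr k u v : dot u (k *: v) = k * dot u v.
Proof. by rewrite !dotE !mxE; ring. Qed.

Lemma dot_ge0 u : 0 <= dot u u.
Proof. by rewrite dotE -!expr2 !addr_ge0 ?sqr_ge0. Qed.

Lemma dot_eq0 u : (dot u u == 0) = (u == 0).
Proof.
apply/eqP/eqP => [|->]; last by rewrite dotE !mxE; ring.
rewrite dotE -!expr2 => /eqP.
rewrite !paddr_eq0 ?addr_ge0 ?sqr_ge0// !sqrf_eq0.
by move=> /andP[/andP[/eqP u0 /eqP u1] /eqP u2]; apply: eq_row3; rewrite !mxE.
Qed.

Lemma dot_gt0 u : (0 < dot u u) = (u != 0).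
Proof. by rewrite lt_def dot_eq0 dot_ge0 andbT. Qed.

Lemma sqr_enorm u : enorm u ^+ 2 = dot u u.
Proof. by rewrite sqr_sqrtr ?dot_ge0. Qed.

Lemma enorm_gt0 u : (0 < enorm u) = (u != 0).
Proof. by rewrite sqrtr_gt0 dot_gt0. Qed.

Lemma enorm_neq0 u : (enorm u != 0) = (u != 0).
Proof. by rewrite -enorm_gt0 lt0r sqrtr_ge0 andbT. Qed.

Lemma enormZ k u : enorm (k *: u) = `|k| * enorm u.
Proof. by rewrite /enorm dotZl dotZr mulrA -expr2 sqrtrM ?sqr_ge0// sqrtr_sqr. Qed.

(** Cauchy-Schwarz: it bounds the argument of [acos] in [line_angle] by 1, so that the cosine of the
    angle can be recovered. *)
Lemma dot_le_enorm u v : `|dot u v| <= enorm u * enorm v.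
Proof.
rewrite -ler_sqr ?nnegrE ?mulr_ge0 ?sqrtr_ge0//.
rewrite real_normK ?num_real// exprMn !sqr_enorm -subr_ge0.
(* Lagrange's identity *)
have -> : dot u u * dot v v - dot u v ^+ 2 = dot (cross u v) (cross u v).
  by have [e0 e1 e2] := crossE u v; rewrite !dotE e0 e1 e2; ring.
exact: dot_ge0.
Qed.

Lemma cross_dot u v : dot (cross u v) u = 0 /\ dot (cross u v) v = 0.
Proof. by have [e0 e1 e2] := crossE u v; rewrite !dotE e0 e1 e2; split; ring. Qed.

Lemma orthonormal_decomp u v x : dot u u = 1 -> dot v v = 1 -> dot u v = 0 ->
  x = dot x u *: u + dot x v *: v + dot x (cross u v) *: cross u v.
Proof.
move=> uu vv uv; have [e0 e1 e2] := crossE u v.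
(* Cramer's rule in the basis u, v, u x v, whose Gram determinant is 1. *)
have -> : x = (dot u u * dot v v - dot u v ^+ 2) *: x.
  by rewrite uu vv uv mulr1 expr0n subr0 scale1r.
have key : (dot u u * dot v v - dot u v ^+ 2) *: x =
  (dot x u * dot v v - dot x v * dot u v) *: u +
  (dot x v * dot u u - dot x u * dot u v) *: v +
  dot x (cross u v) *: cross u v.
  (* The cross product is made opaque, so that [mxE] leaves it alone and its coordinates are
     rewritten by [e0], [e1], [e2] only. *)
  move: (cross u v) e0 e1 e2 => w e0 e1 e2.
  by apply: eq_row3; rewrite !mxE !dotE e0 e1 e2; ring.
rewrite {1}key uu vv uv !mulr0 !mulr1 !subr0 expr0n subr0 scale1r//.
Qed.

Lemma cross_norm1 u v : dot u u = 1 -> dot v v = 1 -> dot u v = 0 ->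
  dot (cross u v) (cross u v) = 1.
Proof.
move=> uu vv uv; have [e0 e1 e2] := crossE u v.
have -> : dot (cross u v) (cross u v) = dot u u * dot v v - dot u v ^+ 2.
  by rewrite !dotE e0 e1 e2; ring.
by rewrite uu vv uv mulr1 expr0n subr0.
Qed.

End DotCross.

(** * Calculus of repeatedly differentiable functions on an open set *)

Section Regularity.
Variables (R : realType) (I : set R).
Hypothesis openI : open I.

Definition derivable_on (V : normedModType R) (f : R -> V) :=
  forall t, I t -> derivable f t 1.

(** This is n-fold differentiability on [I]; it does not assert continuity of the derivative of
    order n. The case n = 0 is vacuous and starts the inductions below. *)
Definition Cn (V : normedModType R) n (f : R -> V) :=
  forall k, (k < n)%N -> derivable_on (derive1n k f).

(** Openness of [I] turns agreement on [I] into agreement near each of its points, hence into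
    equality of derivatives there. *)
Lemma eq_near_open (T : Type) (f g : R -> T) t :
  I t -> {in I, f =1 g} -> \forall s \near t, f s = g s.
Proof.
move=> It fg; apply: filterS (open_nbhs_nbhs (conj openI It)) => s Is.
by apply: fg; exact/mem_set.
Qed.

Lemma eq_derivable_on (V : normedModType R) (f g : R -> V) :
  {in I, f =1 g} -> derivable_on f -> derivable_on g.
Proof.
by move=> fg df t It; apply: near_eq_derivable (df t It); exact: eq_near_open.
Qed.

Lemma eq_derive1_on (V : normedModType R) (f g : R -> V) :
  {in I, f =1 g} -> {in I, derive1 f =1 derive1 g}.
Proof.
move=> fg t /set_mem It.
by rewrite !derive1E; apply: near_eq_derive; exact: eq_near_open.
Qed.

(** Peels off the first derivative rather than the last, so that closure properties follow by
    induction on n from the usual differentiation rules. *)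
Lemma CnS (V : normedModType R) n (f : R -> V) :
  Cn n.+1 f <-> derivable_on f /\ Cn n (derive1 f).
Proof.
split=> [fn|[f0 fn] [|k] kn]; last 2 first.
- exact: f0.
- by rewrite derive1Sn; exact: fn.
split=> [|k kn]; first exact: (fn 0%N).
by rewrite -derive1Sn; exact: (fn k.+1).
Qed.

Lemma Cn_pred (V : normedModType R) n (f : R -> V) : Cn n.+1 f -> Cn n f.
Proof. by move=> fn k kn; apply: fn; exact: ltnW. Qed.

Lemma eq_Cn (V : normedModType R) n (f g : R -> V) :
  {in I, f =1 g} -> Cn n f -> Cn n g.
Proof.
elim: n f g => [|n IH] f g fg; first by move=> _ k.
move=> /CnS[f0 fn]; apply/CnS; split; first exact: eq_derivable_on f0.
by apply: IH fn; exact: eq_derive1_on.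
Qed.

Lemma CnD n (f g : R -> R) : Cn n f -> Cn n g -> Cn n (fun t => f t + g t).
Proof.
elim: n f g => [|n IH] f g; first by move=> _ _ k.
move=> /CnS[f0 fn] /CnS[g0 gn]; apply/CnS; split=> [t It|].
  by apply: derivableD; [exact: f0|exact: g0].
apply: eq_Cn (IH _ _ fn gn) => t /set_mem It.
by rewrite !derive1E deriveD//; [exact: f0|exact: g0].
Qed.

(** The product rule contains f and g themselves besides their derivatives, hence the descent by
    [Cn_pred] before the induction hypothesis applies. *)
Lemma CnM n (f g : R -> R) : Cn n f -> Cn n g -> Cn n (fun t => f t * g t).
Proof.
elim: n f g => [|n IH] f g; first by move=> _ _ k.
move=> fn1 gn1; have /CnS[f0 fn] := fn1; have /CnS[g0 gn] := gn1.
apply/CnS; split=> [t It|].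
  by apply: derivableM; [exact: f0|exact: g0].
apply: eq_Cn (CnD (IH _ _ (Cn_pred fn1) gn) (IH _ _ (Cn_pred gn1) fn)).
move=> t /set_mem It.
by rewrite !derive1E deriveM//; [exact: f0|exact: g0].
Qed.

Lemma Cn_cst n (k : R) : Cn n (fun=> k).
Proof.
elim: n k => [k j //|n IH k]; apply/CnS; split=> [t _|]; first exact: derivable_cst.
by apply: eq_Cn (IH 0) => t _; rewrite derive1_cst.
Qed.

Lemma CnN n (f : R -> R) : Cn n f -> Cn n (fun t => - f t).
Proof.
by move=> fn; apply: eq_Cn (CnM (@Cn_cst n (-1)) fn) => t _; exact: mulN1r.
Qed.

(** Bootstrapping: the derivative of 1/f is -(1/f)^2 f', and the induction hypothesis already gives
    1/f one order less. *)
Lemma CnV n (f : R -> R) : {in I, forall t, f t != 0} -> Cn n f ->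
  Cn n (fun t => (f t)^-1).
Proof.
move=> f_neq0; elim: n => [|n IH]; first by move=> _ k.
move=> fn1; have /CnS[f0 fn] := fn1; have Vn := IH (Cn_pred fn1).
apply/CnS; split=> [t It|].
  by apply: derivableV; [exact/f_neq0/mem_set|exact: f0].
apply: eq_Cn (CnM (CnN (CnM Vn Vn)) fn) => t It.
rewrite !derive1E deriveV ?f_neq0//; last exact/f0/set_mem.
by rewrite -exprVn expr2.
Qed.

(** The same bootstrapping with the derivative f' / (2 sqrt f); positivity of f keeps the square
    root differentiable and the denominator nonzero. *)
Lemma Cn_sqrt n (f : R -> R) : {in I, forall t, 0 < f t} -> Cn n f ->
  Cn n (fun t => Num.sqrt (f t)).
Proof.
move=> f_gt0; elim: n => [|n IH]; first by move=> _ k.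
move=> fn1; have /CnS[f0 fn] := fn1.
have Dsqrt t : I t -> is_derive t 1 (fun t => Num.sqrt (f t))
    ((2 * Num.sqrt (f t))^-1 * derive1 f t).
  move=> It; have ft := f_gt0 _ (mem_set It).
  have [dsq e] := is_derive1_sqrt ft.
  split.
    by apply/derivable1_diffP/differentiable_comp;
      apply/derivable1_diffP; [exact: f0|].
  by rewrite -derive1E (derive1_comp (f0 _ It) dsq) derive1E e.
apply/CnS; split=> [t /Dsqrt[]//|].
have sn : Cn n (fun t => 2 * Num.sqrt (f t)).
  by apply: CnM; [exact: Cn_cst|exact/IH/Cn_pred].
apply: eq_Cn (CnM (CnV _ sn) fn) => t It.
  by have [_ e] := Dsqrt _ (set_mem It); rewrite [RHS]derive1E e.
by rewrite mulf_neq0// gt_eqF// sqrtr_gt0 f_gt0.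
Qed.

(** Reduces vector fields to the scalar closure lemmas. Derivation commutes with taking a coordinate
    only where the field is derivable, so derivability comes first at each order. *)
Lemma Cn_coordP m n (X : R -> 'rV[R]_m) :
  Cn n X <-> forall i, Cn n (fun t => X t 0 i).
Proof.
have dcoord (Y : R -> 'rV[R]_m) :
    derivable_on Y <-> forall i, derivable_on (fun t => Y t 0 i).
  split=> dY; first by move=> i t /dY /derivable_mxP.
  by move=> t It; apply/derivable_mxP => i j; rewrite (ord1 i); exact: dY.
have ecoord (Y : R -> 'rV[R]_m) : derivable_on Y ->
    forall i, {in I, (fun t => derive1 Y t 0 i) =1 derive1 (fun t => Y t 0 i)}.
  by move=> dY i t /set_mem/dY dYt; rewrite !derive1E (derive_mx dYt) mxE.
elim: n X => [|n IH] X; first by split=> [_ i k|_ k].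
split=> [/CnS[dX Xn] i|Xn].
  apply/CnS; split; first exact: (dcoord X).1.
  by apply: eq_Cn (ecoord _ dX i) ((IH _).1 Xn i).
have dX : derivable_on X by apply/dcoord => i; have /CnS[] := Xn i.
apply/CnS; split; first exact: dX.
apply: (IH _).2 => i; have /CnS[_] := Xn i.
by apply: eq_Cn => t It; rewrite (ecoord _ dX).
Qed.

Definition smooth (V : normedModType R) (f : R -> V) := forall n, Cn n f.

Lemma smooth_derive1 (V : normedModType R) (f : R -> V) :
  smooth f -> smooth (derive1 f).
Proof. by move=> fs n; have /CnS[] := fs n.+1. Qed.

Lemma smooth_derivable (V : normedModType R) (f : R -> V) :
  smooth f -> derivable_on f.
Proof. by move=> fs; have /CnS[] := fs 1%N. Qed.

Lemma smooth_dot (X Y : R -> 'rV[R]_3) :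
  smooth X -> smooth Y -> smooth (fun t => dot (X t) (Y t)).
Proof.
move=> Xs Ys n; have /Cn_coordP Xn := Xs n; have /Cn_coordP Yn := Ys n.
apply: (@eq_Cn _ _ (fun t =>
  X t 0 0 * Y t 0 0 + X t 0 1 * Y t 0 1 + X t 0 (-1) * Y t 0 (-1))).
  by move=> t _; rewrite dotE.
by apply: CnD; [apply: CnD|]; apply: CnM (Xn _) (Yn _).
Qed.

Lemma smooth_enorm (X : R -> 'rV[R]_3) : {in I, forall t, X t != 0} ->
  smooth X -> smooth (fun t => enorm (X t)).
Proof.
move=> X0 Xs n; apply: Cn_sqrt; last exact: smooth_dot.
by move=> t It; rewrite dot_gt0 X0.
Qed.

Lemma smooth_invr (f : R -> R) : {in I, forall t, f t != 0} ->
  smooth f -> smooth (fun t => (f t)^-1).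
Proof. by move=> f0 fs n; exact: CnV. Qed.

Lemma smooth_scale m (f : R -> R) (X : R -> 'rV[R]_m) :
  smooth f -> smooth X -> smooth (fun t => f t *: X t).
Proof.
move=> fs Xs n; apply/Cn_coordP => i; have /Cn_coordP Xn := Xs n.
by apply: eq_Cn (CnM (fs n) (Xn i)) => t _; rewrite mxE.
Qed.

Lemma smooth_cross (X Y : R -> 'rV[R]_3) :
  smooth X -> smooth Y -> smooth (fun t => cross (X t) (Y t)).
Proof.
move=> Xs Ys n; apply/Cn_coordP => i.
have /Cn_coordP Xn := Xs n; have /Cn_coordP Yn := Ys n.
apply: (@eq_Cn _ _ (fun t => X t 0 (i + 1) * Y t 0 (i - 1) +
  - (X t 0 (i - 1) * Y t 0 (i + 1)))) => [t _|]; first by rewrite mxE.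
by apply: CnD; [|apply: CnN]; apply: CnM.
Qed.

Lemma is_derive_coord m (X : R -> 'rV[R]_m) t i : derivable X t 1 ->
  is_derive t 1 (fun s => X s 0 i) (derive1 X t 0 i).
Proof.
move=> dX; split; first exact: (derivable_mxP _ _ _).1 dX _ _.
by rewrite derive1E (derive_mx dX) mxE.
Qed.

Lemma is_derive_dot (X Y : R -> 'rV[R]_3) t :
  derivable X t 1 -> derivable Y t 1 ->
  is_derive t 1 (fun s => dot (X s) (Y s))
    (dot (derive1 X t) (Y t) + dot (X t) (derive1 Y t)).
Proof.
move=> dX dY.
pose D i := is_deriveM (is_derive_coord i dX) (is_derive_coord i dY).
have [d e] := is_deriveD (is_deriveD (D 0) (D 1)) (D (-1)).
have E : (fun s => X s 0 0) * (fun s => Y s 0 0) +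
    (fun s => X s 0 1) * (fun s => Y s 0 1) +
    (fun s => X s 0 (-1)) * (fun s => Y s 0 (-1)) =
    fun s => dot (X s) (Y s).
  by apply/funext => s; rewrite dotE.
rewrite E in d e; split=> //.
by rewrite e !dotE /GRing.scale/=; ring.
Qed.

Lemma derive1_dot (X Y : R -> 'rV[R]_3) t :
  derivable X t 1 -> derivable Y t 1 ->
  derive1 (fun s => dot (X s) (Y s)) t =
    dot (derive1 X t) (Y t) + dot (X t) (derive1 Y t).
Proof. by move=> dX dY; have [_ e] := is_derive_dot dX dY; rewrite derive1E. Qed.

(** Mean value theorem on the segment between the two points, which lies in [I] because [I] is an
    interval. *)
Lemma derive1_eq0_cst (f : R -> R) : is_interval I -> derivable_on f ->
  (forall t, I t -> derive1 f t = 0) -> forall s t, I s -> I t -> f s = f t.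
Proof.
move=> itvI df f'0.
have le_cst s t : I s -> I t -> s <= t -> f s = f t.
  move=> Is It st.
  have Isub x : x \in `[s, t]%R -> I x.
    by rewrite in_itv/=; exact: itvI.
  have [||c /Isub Ic] := @MVT_segment _ f (derive1 f) s t st.
  - move=> x xst; rewrite derive1E; apply: derivableP; apply/df/Isub.
    exact: subset_itv_oo_cc.
  - apply: derivable_within_continuous => x /Isub; exact: df.
  - by rewrite f'0// mul0r => /eqP; rewrite subr_eq0 => /eqP.
by move=> s t Is It; have [|/ltW] := leP s t => ?; [|apply/esym]; exact: le_cst.
Qed.

End Regularity.

(** * Frenet equations, Lancret's theorem and the analytic form of slant helices *)

Section FrenetEquations.
Variables (R : realType) (I : set R) (a : R -> 'rV[R]_3).
Hypothesis a_frenet : frenet_curve I a.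

Let openI : open I. Proof. by case: a_frenet => -[]. Qed.

Let itvI : is_interval I. Proof. by case: a_frenet => -[]. Qed.

(** The Frenet equations below keep the speed as a factor, because [lancret] will be applied to
    tangent indicatrices, which need not have unit speed. *)
Let speed t := enorm (derive1 a t).

Let speed_gt0 t : I t -> 0 < speed t.
Proof. by case: a_frenet => _ a0 /a0[+ _]; rewrite enorm_gt0. Qed.

Lemma curvature_gt0 t : I t -> 0 < curvature a t.
Proof. by case: a_frenet => _ a0 /a0[_]; rewrite lt0r sqrtr_ge0 andbT. Qed.

Lemma frenet_smooth : smooth I a.
Proof. by case: a_frenet => -[_ _ _ a_smooth] _ n k _ t; exact: a_smooth. Qed.

Let smooth_inv_enorm (X : R -> 'rV[R]_3) : (forall t, I t -> 0 < enorm (X t)) ->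
  smooth I X -> smooth I (fun t => (enorm (X t))^-1).
Proof.
move=> X0 Xs; apply: (smooth_invr openI) => [t /set_mem/X0/gt_eqF->//|].
by apply: (smooth_enorm openI) Xs => t /set_mem/X0; rewrite enorm_gt0.
Qed.

Let smooth_arc_derive (X : R -> 'rV[R]_3) :
  smooth I X -> smooth I (arc_derive a X).
Proof.
move=> Xs; apply: (smooth_scale openI _ (smooth_derive1 Xs)).
exact: smooth_inv_enorm speed_gt0 (smooth_derive1 frenet_smooth).
Qed.

Lemma smooth_tangent : smooth I (tangent a).
Proof. exact: smooth_arc_derive frenet_smooth. Qed.

Lemma smooth_normal : smooth I (normal a).
Proof.
have Ts := smooth_arc_derive smooth_tangent.
by apply: (smooth_scale openI _ Ts); exact: smooth_inv_enorm curvature_gt0 Ts.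
Qed.

Lemma smooth_binormal : smooth I (binormal a).
Proof. exact: smooth_cross openI _ _ smooth_tangent smooth_normal. Qed.

Let derive1_speed X t : I t -> derive1 X t = speed t *: arc_derive a X t.
Proof.
move=> /speed_gt0 st; rewrite scalerA mulfV ?scale1r//.
by rewrite gt_eqF.
Qed.

Let dot_normalized (u : 'rV[R]_3) :
  0 < enorm u -> dot ((enorm u)^-1 *: u) ((enorm u)^-1 *: u) = 1.
Proof.
by move=> u0; rewrite dotZl dotZr -sqr_enorm; field; rewrite gt_eqF.
Qed.

Lemma dot_tangent t : I t -> dot (tangent a t) (tangent a t) = 1.
Proof. by move=> It; exact/dot_normalized/speed_gt0. Qed.

Lemma dot_normal t : I t -> dot (normal a t) (normal a t) = 1.
Proof. by move=> It; exact/dot_normalized/curvature_gt0. Qed.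

(** Product rule applied to a constant dot product. It gives the skew-symmetry of the Frenet
    matrix. *)
Let dot_cst_derive1 (X Y : R -> 'rV[R]_3) c t : I t ->
  smooth I X -> smooth I Y -> (forall s, I s -> dot (X s) (Y s) = c) ->
  dot (derive1 X t) (Y t) = - dot (derive1 Y t) (X t).
Proof.
move=> It Xs Ys XYc; apply/eqP; rewrite -addr_eq0 (dotC _ (X t)).
rewrite -derive1_dot//; [|exact: (smooth_derivable Xs)|exact: (smooth_derivable Ys)].
rewrite (@eq_derive1_on _ _ openI _ _ (cst c)) ?derive1_cst//; last exact/mem_set.
by move=> s /set_mem/XYc.
Qed.

Let dot_derive1_unit (X : R -> 'rV[R]_3) t : I t ->
  smooth I X -> (forall s, I s -> dot (X s) (X s) = 1) ->
  dot (derive1 X t) (X t) = 0.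
Proof. by move=> It Xs X1; have := dot_cst_derive1 It Xs Xs X1; lra. Qed.

Lemma derive1_tangent t : I t ->
  derive1 (tangent a) t = (speed t * curvature a t) *: normal a t.
Proof.
move=> It; rewrite derive1_speed// [in RHS]/normal [RHS]scalerA mulfK//.
by rewrite gt_eqF// curvature_gt0.
Qed.

(** T has unit length, so T' is orthogonal to T, and T' is a nonzero multiple of N. *)
Lemma dot_tangent_normal t : I t -> dot (tangent a t) (normal a t) = 0.
Proof.
move=> It; have := dot_derive1_unit It smooth_tangent dot_tangent.
rewrite derive1_tangent// dotZl dotC => /eqP.
by rewrite !mulf_eq0 (gt_eqF (speed_gt0 It)) (gt_eqF (curvature_gt0 It)) => /eqP.
Qed.

Lemma dot_binormal_tangent t : dot (binormal a t) (tangent a t) = 0.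
Proof. by have [] := cross_dot (tangent a t) (normal a t). Qed.

Lemma dot_binormal_normal t : dot (binormal a t) (normal a t) = 0.
Proof. by have [] := cross_dot (tangent a t) (normal a t). Qed.

Lemma dot_binormal t : I t -> dot (binormal a t) (binormal a t) = 1.
Proof.
by move=> It; rewrite cross_norm1 ?dot_tangent ?dot_normal ?dot_tangent_normal.
Qed.

Lemma frenet_decomp x t : I t ->
  x = dot x (tangent a t) *: tangent a t + dot x (normal a t) *: normal a t +
      dot x (binormal a t) *: binormal a t.
Proof.
move=> It; apply: orthonormal_decomp.
- exact: dot_tangent.
- exact: dot_normal.
- exact: dot_tangent_normal.
Qed.

Let dot_derive1_binormal t : I t ->
  dot (derive1 (binormal a) t) (normal a t) = - (speed t * torsion a t).
Proof. by move=> It; rewrite derive1_speed// dotZl /torsion; ring. Qed.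

(** Components of B' in the frame: zero along B since B is a unit vector, -T' . B = 0 along T, and
    the one along N is the definition of the torsion. *)
Lemma derive1_binormal t : I t ->
  derive1 (binormal a) t = - (speed t * torsion a t) *: normal a t.
Proof.
move=> It; rewrite [LHS](frenet_decomp _ It) dot_derive1_binormal//.
rewrite (dot_derive1_unit It smooth_binormal dot_binormal).
rewrite (dot_cst_derive1 It smooth_binormal smooth_tangent
  (fun s _ => dot_binormal_tangent s)).
rewrite derive1_tangent// dotZl dotC dot_binormal_normal.
by rewrite mulr0 oppr0 !scale0r addr0 add0r.
Qed.

(** By skew-symmetry the components along T and B are -T' . N and -B' . N, both already known. *)
Lemma derive1_normal t : I t ->
  derive1 (normal a) t = - (speed t * curvature a t) *: tangent a t +
                         (speed t * torsion a t) *: binormal a t.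
Proof.
move=> It; rewrite [LHS](frenet_decomp _ It).
rewrite (dot_derive1_unit It smooth_normal dot_normal) scale0r addr0.
congr (_ *: _ + _ *: _).
  rewrite -[LHS]opprK -(dot_cst_derive1 It smooth_tangent smooth_normal
    dot_tangent_normal).
  by rewrite derive1_tangent// dotZl dot_normal// mulr1.
rewrite -[LHS]opprK -(dot_cst_derive1 It smooth_binormal smooth_normal
  (fun s _ => dot_binormal_normal s)).
by rewrite dot_derive1_binormal// opprK.
Qed.

Let derive1_dot_cst (X : R -> 'rV[R]_3) u t : I t -> derivable_on I X ->
  derive1 (fun s => dot (X s) u) t = dot (derive1 X t) u.
Proof.
move=> It dX; rewrite (derive1_dot (dX _ It) (derivable_cst u t 1)).
(* The term [dot (X t) 0] vanishes by writing the zero vector as [0 *: 0]; the same device recurs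
   below. *)
by rewrite derive1_cst [X in _ + X]dotC -(scale0r 0) dotZl mul0r addr0.
Qed.

Let dot_cst_derive1_eq0 (X : R -> 'rV[R]_3) u c t : I t -> derivable_on I X ->
  (forall s, I s -> dot (X s) u = c) -> dot (derive1 X t) u = 0.
Proof.
move=> It dX Xc; rewrite -(derive1_dot_cst _ It dX).
rewrite (@eq_derive1_on _ _ openI _ _ (cst c)) ?derive1_cst//; last exact/mem_set.
by move=> s /set_mem/Xc.
Qed.

Let derive1_eq0_dot_cst (X : R -> 'rV[R]_3) u : derivable_on I X ->
  (forall s, I s -> dot (derive1 X s) u = 0) ->
  forall s t, I s -> I t -> dot (X s) u = dot (X t) u.
Proof.
move=> dX X'u; apply: (derive1_eq0_cst itvI).
  by move=> t It; have [] := is_derive_dot (dX _ It) (derivable_cst u t 1).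
by move=> t It; rewrite (derive1_dot_cst _ It dX) X'u.
Qed.

(** If torsion/curvature is c, then cT + B is a constant axis. Conversely, an axis u is orthogonal
    to N, and its constant components c along T and d along B satisfy torsion * d = curvature *
    c. *)
Lemma lancret : general_helix I a <->
  exists u, u != 0 /\ exists c, forall t, I t -> dot (tangent a t) u = c.
Proof.
case: (a_frenet) => -[_ _ [t0 It0] _] _.
have speedN0 t : I t -> speed t != 0 by move=> It; rewrite gt_eqF ?speed_gt0.
have curvN0 t : I t -> curvature a t != 0.
  by move=> It; rewrite gt_eqF ?curvature_gt0.
split=> [[c torc]|[u [u0 [c Tc]]]].
  (* The derivative of this field is speed * (c * curvature - torsion) times N, which vanishes. *)
  pose X t := c *: tangent a t + binormal a t.
  have dX s : I s ->
      is_derive s 1 X (c *: derive1 (tangent a) s + derive1 (binormal a) s).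
    move=> Is; have dT := smooth_derivable smooth_tangent Is.
    have dB := smooth_derivable smooth_binormal Is.
    rewrite !derive1E.
    exact: is_deriveD (is_deriveZ c (derivableP dT)) (derivableP dB).
  have X'0 s : I s -> derive1 X s = 0.
    move=> Is; have [_ e] := dX _ Is; rewrite derive1E e.
    rewrite derive1_tangent// derive1_binormal// scalerA -scalerDl.
    have -> : torsion a s = c * curvature a s by rewrite -(torc _ Is) divfK ?curvN0.
    by rewrite (_ : _ + _ = 0) ?scale0r//; ring.
  have dXT t : I t -> dot (X t) (tangent a t) = c.
    by move=> It; rewrite dotDl dotZl dot_tangent// dot_binormal_tangent mulr1 addr0.
  exists (X t0); split.
    apply/eqP => X0; have : dot (X t0) (binormal a t0) = 1.
      by rewrite dotDl dotZl dotC dot_binormal_tangent mulr0 add0r dot_binormal.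
    by rewrite X0 -(scale0r 0) dotZl mul0r => /eqP; rewrite eq_sym oner_eq0.
  exists c => t It; rewrite -(dXT _ It) dotC.
  (* Here [tangent a t] is frozen as the fixed vector, and only the point where [X] is evaluated
     moves from [t0] to [t]. *)
  apply: derive1_eq0_dot_cst It0 It => [s Is|s Is]; first by have [] := dX _ Is.
  by rewrite X'0// -(scale0r 0) dotZl mul0r.
have Nu t : I t -> dot (normal a t) u = 0.
  move=> It; have := dot_cst_derive1_eq0 It (smooth_derivable smooth_tangent) Tc.
  rewrite derive1_tangent// dotZl => /eqP.
  by rewrite !mulf_eq0 (negPf (curvN0 _ It)) (negPf (speedN0 _ It))/= => /eqP.
pose d := dot (binormal a t0) u.
have Bu t : I t -> dot (binormal a t) u = d.
  move=> It; apply: (derive1_eq0_dot_cst (smooth_derivable smooth_binormal)) It It0.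
  by move=> s Is; rewrite derive1_binormal// dotZl Nu// mulr0.
(* Differentiate N . u = 0, expand N' by the Frenet equation and cancel the speed. *)
have cd t : I t -> torsion a t * d = curvature a t * c.
  move=> It; have := dot_cst_derive1_eq0 It (smooth_derivable smooth_normal) Nu.
  rewrite derive1_normal// dotDl
    (dotZl _ (tangent _ _)) (dotZl _ (binormal _ _))
    Tc// Bu// => e.
  apply: (mulfI (speedN0 _ It)); lra.
(* If d were zero, c would be zero too, and u would have no component in the frame at [t0]. *)
have d0 : d != 0.
  apply: contra_neq u0 => d0; have /esym/eqP := cd _ It0.
  rewrite d0 mulr0 mulf_eq0 (negPf (curvN0 _ It0))/= => /eqP c0.
  rewrite (frenet_decomp u It0) !(dotC u) Tc// Nu// -/d d0 c0.
  by rewrite !scale0r !addr0.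
exists (c / d) => t It; have := cd _ It; have := curvN0 _ It.
by move=> k0 e; apply/eqP; rewrite eqr_div// e mulrC.
Qed.

(** The angle between lines determines N . u only up to sign. The sign is fixed by
    differentiability: N . u has constant square on an interval, hence is itself constant. *)
Lemma slant_helixP : slant_helix I a <->
  exists u, u != 0 /\ exists c, forall t, I t -> dot (normal a t) u = c.
Proof.
have normal1 t : I t -> enorm (normal a t) = 1.
  by move=> It; rewrite /enorm dot_normal// sqrtr1.
split=> [[_ [u [u0 [theta Nu]]]]|[u [u0 [c Nu]]]]; last first.
  split=> //; exists u; split=> //; exists (acos (`|c| / enorm u)) => t It.
  by rewrite /line_angle Nu// normal1// mul1r.
have eu0 : 0 < enorm u by rewrite enorm_gt0.
have absNu t : I t -> `|dot (normal a t) u| = cos theta * enorm u.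
  move=> It; rewrite -(Nu _ It) /line_angle normal1// mul1r acosK.
    by rewrite divfK// gt_eqF.
  rewrite in_itv/= ler_pdivrMr// mul1r; apply/andP; split.
    by rewrite (@le_trans _ _ 0) ?lerN10// divr_ge0// ltW.
  by rewrite (le_trans (dot_le_enorm _ _))// normal1// mul1r.
(* The value zero is treated apart, since the other case divides by N . u. *)
exists u; split=> //; have [c0|c0] := eqVneq (cos theta * enorm u) 0.
  by exists 0 => t It; apply/eqP; rewrite -normr_eq0 absNu// c0.
case: (a_frenet) => -[_ _ [t0 It0] _] _.
have dN := smooth_derivable smooth_normal.
exists (dot (normal a t0) u) => t It.
apply: (derive1_eq0_dot_cst dN) It It0 => s Is.
(* The square of h = N.u is a nonzero constant, so 2 h h' = 0 with h != 0. *)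
have hs0 : dot (normal a s) u != 0 by rewrite -normr_eq0 absNu.
pose h r := dot (normal a r) u.
have dh : is_derive s 1 h (dot (derive1 (normal a) s) u).
  split; first by have [] := is_derive_dot (dN _ Is) (derivable_cst u s 1).
  by rewrite -derive1E (derive1_dot_cst u Is dN).
have [_] := is_deriveM dh dh.
rewrite -derive1E (@eq_derive1_on _ _ openI _ _ (cst ((cos theta * enorm u) ^+ 2))).
- rewrite derive1_cst /GRing.scale/= -mulrDl => /esym/eqP.
  by rewrite mulf_eq0 -mulr2n mulrn_eq0 (negPf hs0)/= => /eqP.
- by move=> r /set_mem Ir; rewrite /= -(absNu _ Ir) real_normK ?num_real// expr2.
- exact/mem_set.
Qed.

End FrenetEquations.

(** * The tangent indicatrix of a unit-speed curve *)

Section TangentIndicatrix.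
Variables (R : realType) (I : set R) (g : R -> 'rV[R]_3).
Hypotheses (g_frenet : frenet_curve I g) (g_arclength : arclength_param I g).

(** At unit speed the arclength derivative of T is T' itself, so the definition of N is T' / |T'|,
    the normalized velocity of T. *)
Lemma tangent_tangent : {in I, tangent (tangent g) =1 normal g}.
Proof.
move=> t /set_mem It; rewrite /normal /curvature /arc_derive g_arclength//.
by rewrite invr1 scale1r.
Qed.

(** Needed before Lancret's theorem can be applied to T. Its velocity is curvature * N and its unit
    tangent is N, so regularity is clear and nonzero curvature amounts to N' != 0. *)
Lemma frenet_curve_tangent : frenet_curve I (tangent g).
Proof.
have [[openI itvI I0 _] g0] := g_frenet.
have Ts := smooth_tangent g_frenet.
have T'E t : I t -> derive1 (tangent g) t = curvature g t *: normal g t.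
  by move=> It; rewrite (derive1_tangent g_frenet It) g_arclength// mul1r.
have T'0 t : I t -> derive1 (tangent g) t != 0.
  move=> It; rewrite T'E// -enorm_gt0 enormZ /enorm (dot_normal g_frenet It).
  by rewrite sqrtr1 mulr1 normr_gt0 gt_eqF ?(curvature_gt0 g_frenet It).
split; first by split=> // n t; exact: (Ts n.+1 n (ltnSn n)).
move=> t It; split; first exact: T'0.
have v0 : (enorm (derive1 (tangent g) t))^-1 != 0.
  by rewrite invr_neq0// enorm_neq0 T'0.
rewrite /curvature /arc_derive enorm_neq0 scaler_eq0 (negPf v0) orFb.
rewrite (eq_derive1_on openI tangent_tangent (mem_set It)).
(* N' has the nonzero component - kappa along T *)
apply/eqP => N'0.
have : dot (derive1 (normal g) t) (tangent g t) = - curvature g t.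
  rewrite (derive1_normal g_frenet It) dotDl
    (dotZl _ (tangent _ _)) (dotZl _ (binormal _ _))
    (dot_tangent g_frenet It) dot_binormal_tangent.
  by rewrite g_arclength// mul1r mulr1 mulr0 addr0.
rewrite N'0 -(scale0r 0) dotZl mul0r => /eqP.
by rewrite eq_sym oppr_eq0 gt_eqF ?(curvature_gt0 g_frenet It).
Qed.

Lemma slant_helix_tangentP : slant_helix I g <-> spherical_helix I (tangent g).
Proof.
have NT t : I t -> normal g t = tangent (tangent g) t.
  by move=> It; rewrite tangent_tangent//; exact/mem_set.
have Tf := frenet_curve_tangent.
split=> [/(slant_helixP g_frenet)[u [u0 [c Nu]]]|
    [_ _ /(lancret Tf)[u [u0 [c Nu]]]]].
  split=> //; first by move=> t It; rewrite /enorm (dot_tangent g_frenet It) sqrtr1.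
  by apply/(lancret Tf); exists u; split=> //; exists c => t It; rewrite -NT ?Nu.
apply/(slant_helixP g_frenet).
by exists u; split=> //; exists c => t It; rewrite NT ?Nu.
Qed.

End TangentIndicatrix.

(** * Transfer of the slant helix property along a Bertrand pair *)

Lemma line_angle_sign (R : realType) (eps : R) (u v : 'rV[R]_3) :
  eps = 1 \/ eps = -1 -> line_angle (eps *: u) v = line_angle u v.
Proof.
by case=> ->; rewrite /line_angle enormZ dotZl normrM ?normrN !normr1 !mul1r.
Qed.

(** The same direction and angle serve both curves, the sign [eps] being invisible to an unoriented
    angle. Surjectivity of [phi] carries the property from [I] to all of [J]; the way back uses that
    [phi] maps [I] into [J]. *)
Lemma bertrand_slant_helix (R : realType) (I J : set R) (g gm : R -> 'rV[R]_3) :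
  frenet_curve I g -> frenet_curve J gm -> bertrand_pair I J g gm ->
  slant_helix I g <-> slant_helix J gm.
Proof.
move=> gf gmf [phi [[phiIJ _ phi_surj] [eps [lambda [eps1 _ corr]]]]].
have same u s : I s ->
    line_angle (normal g s) u = line_angle (normal gm (phi s)) u.
  by move=> /corr[-> _]; rewrite line_angle_sign.
split=> -[_ [u [u0 [theta ang]]]]; split=> //; exists u; split=> //; exists theta.
  by move=> _ /phi_surj[s Is <-]; rewrite -same ?ang.
by move=> s Is; rewrite same ?ang//; exact: phiIJ.
Qed.

Theorem theorem21 (R : realType) (I J : set R) (g gm : R -> 'rV[R]_3)
  (g_curve : frenet_curve I g) (gm_curve : frenet_curve J gm)
  (g_arclength : arclength_param I g) (gm_arclength : arclength_param J gm)
  (pair : bertrand_pair I J g gm)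
  (g_non_helical : ~ general_helix I g)
  (gm_non_helical : ~ general_helix J gm)
  (g_non_planar : non_planar I g) (gm_non_planar : non_planar J gm)
  (g_quotients : admissible_quotients I g)
  (gm_quotients : admissible_quotients J gm) :
  [/\ slant_helix J gm <-> spherical_helix J (tangent gm),
      slant_helix I g <-> spherical_helix J (tangent gm) &
      slant_helix I g <-> spherical_helix I (tangent g)].
Proof.
have gP := slant_helix_tangentP g_curve g_arclength.
have gmP := slant_helix_tangentP gm_curve gm_arclength.
have ggm := bertrand_slant_helix g_curve gm_curve pair.
by split; [exact: gmP|exact: iff_trans ggm gmP|exact: gP].
Qed.
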